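(* For every integer $q\geq 2$, $C(3,q)=[2q/3]^2\,(q-[2q/3])$, where $[x]$ denotes the nearest integer to the real number $x$. In particular, \[ \lim_{q\rightarrow\infty}\frac{C(3,q)}{q^3/3}=\frac49. \]
   Context: Let $F$ be a finite alphabet with $|F|=q$. Two words $u,v\in F^n$ (not necessarily distinct) are overlapping if a non-empty proper prefix of $u$ equals a non-empty proper suffix of $v$, or a non-empty proper prefix of $v$ equals a non-empty proper suffix of $u$. A code $C\subseteq F^n$ is non-overlapping if for all (not necessarily distinct) $u,v\in C$, the words $u$ and $v$ are not overlapping. $C(n,q)$ denotes the maximum cardinality of a non-overlapping code $C\subseteq F^n$ with $|F|=q$. *)

(* Defs.v *)
From HB Require Import structures.
From mathcomp Require Import all_boot all_order all_algebra.
From mathcomp Require Import all_classical all_reals all_analysis.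
From mathcomp Require Import lra.
Set Implicit Arguments.
Unset Strict Implicit.
Unset Printing Implicit Defensive.
Import Order.TTheory GRing.Theory Num.Theory.
Import numFieldNormedType.Exports.
Local Open Scope ring_scope.

(* Some non-empty proper prefix of u is a proper suffix of v.  As u and v have the
   same length n, this common word has some length 0 < k < n: it is take k u,
   and drop (n - k) v is the suffix of v of that length (see prefix_suffixP). *)
Definition prefix_suffix (F : finType) (n : nat) (u v : n.-tuple F) : bool :=
  [exists k : 'I_n, (0 < k)%N && (take k u == drop (n - k) v)].

Definition overlapping (F : finType) (n : nat) (u v : n.-tuple F) : bool :=
  prefix_suffix u v || prefix_suffix v u.

(* u and v are not assumed distinct. *)
Definition non_overlapping (F : finType) (n : nat)
    (A : {set n.-tuple F}) : bool :=
  [forall u in A, forall v in A, ~~ overlapping u v].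

Definition max_non_overlapping (F : finType) (n : nat) : nat :=
  \max_(A : {set n.-tuple F} | non_overlapping A) #|A|.

(* C(n, q), computed over the alphabet {0, ..., q - 1}; by
   max_non_overlappingE any alphabet with q letters gives the same value. *)
Definition Cmax (n q : nat) : nat := max_non_overlapping 'I_q n.

(* The integer nearest to x; half-integers are rounded up. *)
Definition nearest_int (R : realType) (x : R) : int := Num.floor (x + 1 / 2).

Lemma prefix_suffixP (F : finType) (n : nat) (u v : n.-tuple F) :
  reflect (exists w : seq F, [/\ w != [::],
             prefix w u /\ w != u :> seq F & suffix w v /\ w != v :> seq F])
          (prefix_suffix u v).
Proof.
apply: (iffP existsP) => [[k /andP[k0 /eqP kuv]]|[w [w0 [wu wNu] [wv wNv]]]].
  have sk : size (take k u) = k by rewrite size_takel ?size_tuple // ltnW.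
  exists (take k u); split.
  - by rewrite -size_eq0 sk -lt0n.
  - split; first exact: prefix_take.
    by apply/eqP => /(congr1 size); rewrite sk size_tuple => kn;
      have := ltn_ord k; rewrite kn ltnn.
  - split; first by rewrite kuv; exact: suffix_drop.
    by apply/eqP => /(congr1 size); rewrite sk size_tuple => kn;
      have := ltn_ord k; rewrite kn ltnn.
have wn : (size w < n)%N.
  rewrite -[n in (_ < n)%N](size_tuple u) ltn_neqAle size_prefix// andbT.
  apply: contra wNu => /eqP sw.
  by move: wu; rewrite prefixE sw take_size eq_sym.
exists (Ordinal wn) => /=; rewrite lt0n size_eq0 w0 /=.
by move: wu wv; rewrite prefixE suffixE size_tuple => /eqP -> /eqP ->.
Qed.

Lemma max_non_overlappingE (F : finType) (n q : nat) :
  #|F| = q -> max_non_overlapping F n = Cmax n q.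
Proof.
have le (G H : finType) (f : G -> H) (f_inj : injective f) :
    (max_non_overlapping G n <= max_non_overlapping H n)%N.
  apply/bigmax_leqP => A /forall_inP A_no.
  have mf_inj : injective (map_tuple f : n.-tuple G -> n.-tuple H).
    by move=> u v /(congr1 val)/(inj_map f_inj)/val_inj.
  rewrite -(card_imset A mf_inj) /max_non_overlapping.
  apply: (leq_bigmax_cond (F := fun B : {set n.-tuple H} => #|B|)).
  have psE u v : prefix_suffix (map_tuple f u) (map_tuple f v)
      = prefix_suffix u v.
    apply: eq_existsb => k /=.
    by rewrite -map_take -map_drop (inj_eq (inj_map f_inj)).
  apply/forall_inP => _ /imsetP[u uA ->].
  apply/forall_inP => _ /imsetP[v vA ->].
  by rewrite /overlapping !psE; exact: (forall_inP (A_no u uA) v vA).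
move=> <-; apply/eqP; rewrite eqn_leq; apply/andP; split.
- exact: le enum_rank_inj.
- exact: le enum_val_inj.
Qed.

Lemma nearest_intP (R : realType) (x : R) :
  `|x - (nearest_int x)%:~R| <= 1 / 2.
Proof.
have := Num.Theory.floor_le (x + 1 / 2); have := floorD1_gt (x + 1 / 2).
by rewrite /nearest_int intrD; set y := _%:~R; rewrite ler_norml; lra.
Qed.

(* Main.v *)
(** Let [I] be the set of first letters of a non-overlapping code [A] of length
    3, and [J] its complement, which contains all the last letters.  Every
    word [xyz] of [A] has [yz] in [I * J] or [xy] in [I * J] according to
    whether [y] is in [I] or in [J].  A pair in [I * J] cannot be both a suffix
    and a prefix of words of [A], so with [a = #|I|] and [b = #|J|] there are
    [s] such suffixes and [p] such prefixes with [s + p <= a * b], whence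
    [#|A| <= a * s + p * b <= a * b * max a b].  Conversely [I * I * J] is
    non-overlapping for every partition [I], [J] of the alphabet.  So [Cmax 3 q]
    is the maximum of [m ^ 2 * (q - m)], reached at the integer nearest to
    [2 q / 3]. *)
Require Import Defs.
From HB Require Import structures.
From mathcomp Require Import all_boot all_order all_algebra.
From mathcomp Require Import all_classical all_reals all_analysis.
From mathcomp Require Import zify ring lra.
Import Order.TTheory GRing.Theory Num.Theory.
Import numFieldNormedType.Exports.
Local Open Scope classical_set_scope.
Local Open Scope ring_scope.

Lemma tuple3_eta (T : Type) (w : 3.-tuple T) :
  w = [tuple tnth w ord0; tnth w (inord 1); tnth w (inord 2)].
Proof.
case/tupleP: w => x w; case/tupleP: w => y w; case/tupleP: w => z w.
by apply: val_inj; rewrite /= !(tnth_nth x) /= !inordK // (tuple0 w).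
Qed.

(** The common word can only have length 1 or 2; each length gives one disjunct. *)
Lemma prefix_suffix3E (F : finType) (u v : 3.-tuple F) :
  prefix_suffix u v =
  (tnth u ord0 == tnth v (inord 2))
  || ((tnth u ord0, tnth u (inord 1)) == (tnth v (inord 1), tnth v (inord 2))).
Proof.
rewrite [u in LHS]tuple3_eta [v in LHS]tuple3_eta.
apply/existsP/orP => [[[[|[|[|//]]] ltk3]] //= /eqP[]|[/eqP uv|/eqP[uv1 uv2]]].
- by move->; left.
- by move=> -> ->; right.
- by exists (inord 1); rewrite inordK //= uv.
- by exists (inord 2); rewrite inordK //= uv1 uv2.
Qed.

(** Since [u] and [v] range over all ordered pairs, one direction of [overlapping] suffices. *)
Lemma non_overlapping3P (F : finType) (A : {set 3.-tuple F}) :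
  reflect {in A &, forall u v,
      tnth u ord0 <> tnth v (inord 2) /\
      (tnth u ord0, tnth u (inord 1)) <> (tnth v (inord 1), tnth v (inord 2))}
    (non_overlapping A).
Proof.
apply: (iffP forall_inP) => [noA u v uA vA | noA u uA].
  have := forall_inP (noA u uA) v vA.
  rewrite /overlapping !prefix_suffix3E !negb_or.
  by case/andP => /andP[/eqP ? /eqP ?] _.
apply/forall_inP => v vA; rewrite /overlapping !prefix_suffix3E !negb_or.
have [/eqP -> /eqP ->] := noA u v uA vA.
by have [/eqP -> /eqP ->] := noA v u vA uA.
Qed.

Lemma card_non_overlapping3_le (F : finType) (A : {set 3.-tuple F}) :
  non_overlapping A ->
  exists2 m, (m <= #|F|)%N & (#|A| <= m ^ 2 * (#|F| - m))%N.
Proof.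
move=> /non_overlapping3P noA.
pose fst3 (w : 3.-tuple F) := tnth w ord0.
pose mid3 (w : 3.-tuple F) := tnth w (inord 1).
pose lst3 (w : 3.-tuple F) := tnth w (inord 2).
pose I := [set fst3 w | w in A]%SET; pose J := (~: I)%SET.
have lstJ w : w \in A -> lst3 w \in J.
  move=> wA; rewrite inE; apply/imsetP => -[u uA uw].
  by have [/(_ (esym uw))] := noA u w uA wA.
have fstI w : w \in A -> fst3 w \in I by move=> wA; apply: imset_f.
pose AI := [set w in A | mid3 w \in I]%SET.
pose AJ := [set w in A | mid3 w \notin I]%SET.
pose S := [set (mid3 w, lst3 w) | w in AI]%SET.
pose P := [set (fst3 w, mid3 w) | w in AJ]%SET.
have cardSP : (#|S| + #|P| <= #|I| * #|J|)%N.
  have /eqP SP0 : (S :&: P)%SET == finset.set0.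
    rewrite finset.setI_eq0 disjoint_subset.
    apply/fintype.subsetP => _ /imsetP[v /setIdP[vA _] ->]; apply/imsetP => -[u].
    by case/setIdP => uA _ uv; have [_ /(_ (esym uv))] := noA u v uA vA.
  rewrite -cardsX -cardsUI SP0 cards0 addn0; apply: subset_leq_card.
  apply/fintype.subsetP => _ /setUP[] /imsetP[w /setIdP[wA wI] ->].
    by rewrite finset.in_setX wI lstJ.
  by rewrite finset.in_setX fstI //= finset.in_setC wI.
have inj3 (u v : 3.-tuple F) :
    fst3 u = fst3 v -> mid3 u = mid3 v -> lst3 u = lst3 v -> u = v.
  move=> e0 e1 e2; rewrite [u]tuple3_eta [v]tuple3_eta.
  by rewrite -/(fst3 u) -/(mid3 u) -/(lst3 u) e0 e1 e2.
have cardAI : (#|AI| <= #|I| * #|S|)%N.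
  have injf : injective (fun w => (fst3 w, (mid3 w, lst3 w))).
    by move=> u v [*]; apply: inj3.
  rewrite -cardsX -(card_imset _ injf); apply: subset_leq_card.
  apply/fintype.subsetP => _ /imsetP[w wAI ->].
  have /setIdP[/fstI wI _] := wAI.
  by rewrite finset.in_setX wI; apply: imset_f.
have cardAJ : (#|AJ| <= #|P| * #|J|)%N.
  have injf : injective (fun w => ((fst3 w, mid3 w), lst3 w)).
    by move=> u v [*]; apply: inj3.
  rewrite -cardsX -(card_imset _ injf); apply: subset_leq_card.
  apply/fintype.subsetP => _ /imsetP[w wAJ ->].
  have /setIdP[/lstJ wJ _] := wAJ.
  by rewrite finset.in_setX wJ andbT; apply: imset_f.
have cardA : #|A| = (#|AI| + #|AJ|)%N.
  rewrite -(cardsID [set w | mid3 w \in I]%SET A).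
  by congr (_ + _)%N; apply: eq_card => w; rewrite !inE // andbC.
have cardIJ : (#|I| + #|J| = #|F|)%N by rewrite cardsC.
(* The witness [m] is the larger of [#|I|] and [#|J|]: it bounds both coefficients in
   [#|I| * #|S| + #|P| * #|J|], and [#|F| - m] is the other size. *)
have [leJI | /ltnW leIJ] := leqP #|J| #|I|.
  exists #|I|; first by rewrite -cardIJ leq_addr.
  rewrite -cardIJ addKn -mulnn -mulnA.
  apply: leq_trans (leq_mul (leqnn _) cardSP); rewrite cardA mulnDr leq_add //.
  by apply: leq_trans cardAJ _; rewrite mulnC leq_mul.
exists #|J|; first by rewrite -cardIJ leq_addl.
rewrite -cardIJ addnK -mulnn -mulnA [(#|J| * #|I|)%N]mulnC.
apply: leq_trans (leq_mul (leqnn _) cardSP); rewrite cardA mulnDr leq_add //.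
  by apply: leq_trans cardAI _; rewrite leq_mul.
by rewrite mulnC.
Qed.

Lemma max_non_overlapping3_ge (F : finType) (I : {set F}) :
  (#|I| ^ 2 * (#|F| - #|I|) <= max_non_overlapping F 3)%N.
Proof.
pose f (t : F * F * F) := [tuple t.1.1; t.1.2; t.2].
have injf : injective f.
  by move=> [[x y] z] [[x' y'] z'] /(congr1 val) [-> -> ->].
pose A := [set f t | t in finset.setX (finset.setX I I) (~: I)]%SET.
have cardA : #|A| = (#|I| ^ 2 * (#|F| - #|I|))%N.
  by rewrite card_imset // !cardsX (cardsCs (~: I)) finset.setCK mulnn.
rewrite -cardA /max_non_overlapping.
apply: (leq_bigmax_cond (F := fun B : {set 3.-tuple F} => #|B|)).
apply/non_overlapping3P => _ _ /imsetP[[[x y] z] xyz ->] /imsetP[[[x' y'] z'] xyz' ->].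
move: xyz xyz'; rewrite !inE /= => /andP[/andP[xI yI] _] /andP[_ zJ].
rewrite !(tnth_nth x) /= !inordK //=.
(* Either overlap identifies a first or middle letter, in [I], with a last letter, outside [I]. *)
by split=> [xz|[_ yz]]; [rewrite -xz xI in zJ | rewrite -yz yI in zJ].
Qed.

Lemma sqr_mul_subn_max (q m : nat) : (m <= q)%N ->
  (m ^ 2 * (q - m) <= ((2 * q).+1 %/ 3) ^ 2 * (q - (2 * q).+1 %/ 3))%N.
Proof.
set M := (_ %/ 3)%N => mq.
(* Additive variables replace truncated subtraction. As [M - 2k = 3M - 2q], rounding gives
   [|M - 2k| <= 1], all that is used of [M] below. *)
have [k qE] : exists k, q = (M + k)%N by exists (q - M)%N; rewrite /M; lia.
have [Mk kM] : (M <= 2 * k + 1)%N /\ (2 * k <= M + 1)%N by rewrite /M in qE *; lia.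
rewrite qE in mq *; rewrite addKn; clearbody M.
have [leqmM | ltMm] := leqP m M.
  have [d ME] : exists d, M = (m + d)%N by exists (M - m)%N; lia.
  have -> : (M + k - m = k + d)%N by lia.
  case: d ME => [|d] ME; first by rewrite ME !addn0.
  (* With [D = d.+1], the goal reduces to [m^2 D <= (2m + D) D k], which follows from [m <= 2k]. *)
  have : (m * d.+1 * m <= m * d.+1 * (2 * k))%N by rewrite leq_mul //; lia.
  by rewrite ME; nia.
have [e mE] : exists e, m = (M + e.+1)%N by exists (m - M.+1)%N; lia.
have [n kE] : exists n, k = (n + e.+1)%N by exists (k - e.+1)%N; lia.
have -> : (M + k - m = n)%N by lia.
(* With [E = e.+1], the goal reduces to [2MEn + E^2 n <= M^2 E]; it follows from [2n + E <= M] and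
   [n <= M]. *)
have : (M * e.+1 * (2 * n + e.+1) <= M * e.+1 * M)%N by rewrite leq_mul //; lia.
have : (n * (e.+1 * e.+1) <= M * (e.+1 * e.+1))%N by rewrite leq_mul //; lia.
by rewrite mE kE; nia.
Qed.

Lemma Cmax3E (q : nat) :
  Cmax 3 q = (((2 * q).+1 %/ 3) ^ 2 * (q - (2 * q).+1 %/ 3))%N.
Proof.
apply/eqP; rewrite eqn_leq; apply/andP; split.
  apply/bigmax_leqP => A /card_non_overlapping3_le[m]; rewrite card_ord => mq.
  by move/leq_trans; apply; exact: sqr_mul_subn_max.
have mq : ((2 * q).+1 %/ 3 <= q)%N by lia.
pose I := [set i : 'I_q | (i < (2 * q).+1 %/ 3)%N]%SET.
have cardI : #|I| = ((2 * q).+1 %/ 3)%N.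
  have -> : I = [set widen_ord mq i | i in finset.setT]%SET.
    apply/finset.setP => i; rewrite inE; apply/idP/imsetP => [ltim | [j _ ->] //].
      by exists (Ordinal ltim) => //; apply: val_inj.
    by rewrite /=.
  rewrite card_imset ?cardsT ?card_ord //.
  by move=> i j /(congr1 val) /= ij; apply: val_inj.
by have := max_non_overlapping3_ge _ I; rewrite cardI card_ord.
Qed.

(** The fractional part of [2q/3] is 0, 1/3 or 2/3, so no tie occurs and adding 1/3 instead of 1/2
    before taking the floor changes nothing. *)
Lemma nearest_int_two_thirds (R : realType) (q : nat) :
  nearest_int (2 * q%:R / 3 : R) = ((2 * q).+1 %/ 3)%N%:Z.
Proof.
apply: Num.Theory.floor_def; rewrite -[(_ + 1)%R]/(_%:Z + 1%:Z) -PoszD.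
set m := (_ %/ 3)%N.
have h1 : (3 * m <= 2 * q + 1)%N by rewrite /m; lia.
have h2 : (2 * q + 2 <= 3 * m + 3)%N by rewrite /m; lia.
have h3 : (3 * m%:R <= 2 * q%:R + 1 :> R) by rewrite -!natrM natr1 ler_nat; lia.
have h4 : (2 * q%:R + 2 <= 3 * m%:R + 3 :> R).
  by rewrite -!natrM -!natrD ler_nat.
rewrite -!pmulrn natrD; lra.
Qed.

Theorem theorem7 (R : realType) :
  (forall q : nat, (2 <= q)%N ->
     (Cmax 3 q)%:Z = nearest_int (2 * q%:R / 3 : R) ^+ 2
                     * (q%:Z - nearest_int (2 * q%:R / 3 : R)))
  /\ (fun q : nat => (Cmax 3 q)%:R / (q%:R ^+ 3 / 3) : R) @ \oo --> (4 / 9 : R).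
Proof.
split=> [q _|].
  rewrite nearest_int_two_thirds Cmax3E PoszM -subzn; last by lia.
  by rewrite -mulnn PoszM expr2.
(* The index is shifted to keep the denominator nonzero. The rounding error, at most 1/2, vanishes
   after division by [q.+1], and the ratio in the limit is [3 x^2 (1 - x)]. *)
pose x q : R := (nearest_int (2 * q.+1%:R / 3 : R))%:~R / q.+1%:R.
have xlim : x @ \oo --> (2 / 3 : R).
  have x_near q : `|2 / 3 - x q| <= q.+1%:R^-1.
    have q0 : 0 < (q.+1%:R : R) by rewrite ltr0n.
    pose z : R := (nearest_int (2 * q.+1%:R / 3 : R))%:~R.
    have near_z : `|2 * q.+1%:R / 3 - z| <= 1 / 2 := nearest_intP _.
    have -> : 2 / 3 - x q = (2 * q.+1%:R / 3 - z) * q.+1%:R^-1.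
      by rewrite /x -/z; field; rewrite lt0r_neq0.
    rewrite normrM [`|_^-1|]gtr0_norm ?invr_gt0 // ler_piMl ?invr_ge0 ?ltW //.
    by apply: le_lt_trans near_z _; lra.
  apply/cvgrPdist_le => e e0; near=> q; apply: le_trans (x_near q) _.
  near: q; have /cvgr0Pnorm_le/(_ e e0) := @cvg_harmonic R.
  by apply: filterS => q; rewrite ger0_norm ?invr_ge0.
rewrite -cvg_shiftS.
have -> : (4 / 9 : R) = 3 * (2 / 3 * (2 / 3) * (1 - 2 / 3)) by field.
apply: (@cvg_trans _ ((fun q => 3 * (x q * x q * (1 - x q))) @ \oo)).
  apply: near_eq_cvg; apply: nearW => q /=.
  rewrite /x nearest_int_two_thirds Cmax3E natrM natrX natrB; last by lia.
  rewrite -pmulrn; field.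
  by rewrite nat1r pnatr_eq0.
apply: cvgM; first exact: cvg_cst.
by apply: cvgM; [exact: cvgM | apply: cvgB => //; exact: cvg_cst].
Unshelve. all: by end_near.
Qed.
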